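(* There exists a real number $c>0$ such that for all sufficiently large positive integers $n$ with $n\not\equiv 0 \pmod 4$, $$\kappa(n)\geq 1+\frac{c\log n}{n}.$$
   Context: For a real matrix $A$, let $\sigma_{\max}(A)$ and $\sigma_{\min}(A)$ denote its largest and smallest singular values. The condition number of $A$ is $\kappa(A)=\sigma_{\max}(A)/\sigma_{\min}(A)\in[1,\infty]$, with $\kappa(A)=\infty$ if $\sigma_{\min}(A)=0$. For each positive integer $n$, define $\kappa(n):=\min_{A\in\{\pm1\}^{n\times n}}\kappa(A)$, the smallest possible condition number of an $n\times n$ matrix with all entries in $\{\pm1\}$. *)

(* Defs.v *)
From HB Require Import structures.
From mathcomp Require Import all_boot all_order all_algebra.
From mathcomp Require Import all_classical all_reals all_analysis.

Set Implicit Arguments.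
Unset Strict Implicit.
Unset Printing Implicit Defensive.

Import Order.TTheory GRing.Theory Num.Theory.

Local Open Scope classical_set_scope.
Local Open Scope ring_scope.

(* The nonnegative square roots of the eigenvalues of A^T A.  Multiplicities
   are forgotten; they do not affect the largest and smallest elements. *)
Definition singular_values (R : realType) (n : nat) (A : 'M[R]_n) : set R :=
  [set s | 0 <= s /\ eigenvalue (A^T *m A) (s ^+ 2)].

(* For 0 < n the set of singular values is finite and nonempty, so that the
   supremum and infimum below are a maximum and a minimum. *)
Definition sigma_max (R : realType) (n : nat) (A : 'M[R]_n) : R :=
  sup (singular_values A).

Definition sigma_min (R : realType) (n : nat) (A : 'M[R]_n) : R :=
  inf (singular_values A).

Definition cond_number (R : realType) (n : nat) (A : 'M[R]_n) : \bar R :=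
  if sigma_min A == 0 then +oo%E else (sigma_max A / sigma_min A)%:E.

Definition sign_matrices (R : realType) (n : nat) : set 'M[R]_n :=
  [set A | forall i j, A i j = 1 \/ A i j = -1].

(* The infimum is over a finite nonempty set, hence it is a minimum. *)
Definition min_cond_number (R : realType) (n : nat) : \bar R :=
  ereal_inf [set cond_number A | A in @sign_matrices R n].

(* Main.v *)
Require Import Defs.
From HB Require Import structures.
From mathcomp Require Import all_boot all_order all_algebra.
From mathcomp Require Import all_classical all_reals all_analysis.
From mathcomp Require Import complex spectral sesquilinear ring lra.

Set Implicit Arguments.
Unset Strict Implicit.
Unset Printing Implicit Defensive.

Import Order.TTheory GRing.Theory Num.Theory.

Local Open Scope ring_scope.

(** Let [G = A^T *m A] for a sign matrix [A] of order [n].  Its diagonal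
    entries all equal [n], so its eigenvalues have mean [n], and the sum of
    the squares of their deviations from [n] is the sum of the squares of the
    off-diagonal entries of [G].  If [A] is nearly perfectly conditioned, all
    eigenvalues are close to [n], hence the columns of [A] are nearly
    orthogonal.

    When 4 does not divide [n] this is impossible: three sign vectors of
    length [n] cannot be pairwise orthogonal ([dvdn4_orthogonal_columns]), and
    inner products are integers, so among any three distinct columns some pair
    contributes at least 1 to the sum of squares.  Averaging over all triples
    shows that the total is at least [n ^ 2 / 3 - n] ([sign_gram_offdiag],
    [sign_gram_spread]).

    The eigenvalues of [G] and their mean [n] lie between the squares of the
    extreme singular values [m <= M] ([gram_eigenvalue_bounds]), so each
    deviation is at most [M ^ 2 - m ^ 2], and [m ^ 2 <= n].  Together these
    give [n * ((M / m) ^ 2 - 1) ^ 2 >= 1 / 6] for [n >= 6]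
    ([sign_condition_number]).  Thus the condition number exceeds 1 by at
    least a constant over the square root of [n], which dominates
    [ln n / n] because [(ln n) ^ 2 <= 4 * n].

    The moments of the eigenvalues come from the unitary diagonalization of
    [G] over the complex numbers [R[i]] ([symmetric_spectrum]). *)

(** * Spectra of symmetric and Gram matrices *)

(** The spectral theorem, reduced to what moment computations use.  The family
    [r] is the diagonal of a unitary diagonalization over [R[i]]; it lists the
    eigenvalues with multiplicity, and its entries are real because [G] is
    Hermitian. *)
Lemma symmetric_spectrum (R : rcfType) (n : nat) (G : 'M[R]_n) :
  G^T = G ->
  exists r : 'I_n -> R,
    [/\ forall a, eigenvalue G a <-> exists i, a = r i,
        \tr G = \sum_i r i & \tr (G *m G) = \sum_i r i ^+ 2].
Proof.
move=> symG; pose iota : {rmorphism R -> R[i]} := real_complex R.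
pose GC := map_mx iota G.
have hermGC : GC \is hermsymmx.
  apply: realsym_hermsym.
    apply/is_hermitianmxP.
    by rewrite expr0 scale1r map_mx_id // /GC map_trmx symG.
  by apply/mxOverP=> i j; rewrite mxE complex_real.
have /orthomx_spectralP := hermitian_normalmx hermGC.
set P := spectralmx GC; set d := spectral_diag GC => GCE.
have Punit : P \in unitmx by exact: spectral_unit.
have dreal i : exists x : R, d 0 i = iota x.
  have /mxOverP/(_ 0 i) := hermitian_spectral_diag_real hermGC.
  by case/complex_realP=> x ->; exists x.
have [r dE] := choice dreal.
exists r; split.
- move=> a; rewrite -(eigenvalue_map iota) -/GC; split.
    case/eigenvalueP=> v vG v0; pose w := v *m invmx P.
    have wD : w *m diag_mx d = iota a *: w.
      by rewrite /w scalemxAl -vG {1}GCE !mulmxA mulmxK.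
    have w0 : w != 0.
      apply: contra_neq v0 => w0.
      by rewrite -(mulmxKV Punit v) -/w w0 mul0mx.
    have [i wi0] := rV0Pn _ w0.
    (* In the eigenbasis the equation reads [w 0 i * d 0 i = a * w 0 i]. *)
    exists i; apply: (fmorph_inj iota).
    apply: (mulIf wi0); move/rowP/(_ i): wD.
    by rewrite mul_mx_diag [X in X = _]mxE [X in _ = X]mxE dE mulrC.
  case=> i ->; apply/eigenvalueP; exists (delta_mx 0 i *m P).
    rewrite {1}GCE !mulmxA mulmxK // -(rowE i (diag_mx d)) row_diag_mx dE.
    by rewrite scalemxAl.
  apply: contraTneq (oner_neq0 R[i]) => /(congr1 (mulmx^~ (invmx P))).
  rewrite mulmxK // mul0mx => /matrixP/(_ 0 i).
  by rewrite !mxE !eqxx negbK => /eqP.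
- apply: (fmorph_inj iota); rewrite -trace_map_mx -/GC GCE.
  rewrite -mulmxA mxtrace_mulC mulmxK // mxtrace_diag rmorph_sum.
  by apply: eq_bigr => i _; rewrite dE.
- apply: (fmorph_inj iota); rewrite -trace_map_mx map_mxM -/GC GCE.
  rewrite -!mulmxA (mulmxA P) mulmxV // mul1mx mxtrace_mulC !mulmxA mulmxK //.
  rewrite mulmx_diag mxtrace_diag rmorph_sum.
  by apply: eq_bigr => i _; rewrite mxE dE rmorphXn expr2.
Qed.

(** An eigenvector [v] for [a] satisfies [|v A^T|^2 = a |v|^2]. *)
Lemma gram_eigenvalue_ge0 (R : realFieldType) (n : nat) (A : 'M[R]_n) (a : R) :
  eigenvalue (A^T *m A) a -> 0 <= a.
Proof.
case/eigenvalueP=> v vG v0.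
have sq (u : 'rV[R]_n) : (u *m u^T) 0 0 = \sum_k u 0 k ^+ 2.
  by rewrite mxE; apply: eq_bigr => k _; rewrite mxE expr2.
have vv : 0 < (v *m v^T) 0 0.
  have [i vi0] := rV0Pn _ v0; rewrite sq (bigD1 i) //=.
  rewrite ltr_pwDl ?exprn_even_gt0 ?vi0 ?orbT //.
  by apply: sumr_ge0 => k _; rewrite sqr_ge0.
have : 0 <= a * (v *m v^T) 0 0.
  have -> : a * (v *m v^T) 0 0 = ((v *m A^T) *m (v *m A^T)^T) 0 0.
    by rewrite trmx_mul trmxK mulmxA -(mulmxA v) vG -scalemxAl [RHS]mxE.
  by rewrite sq sumr_ge0 // => k _; rewrite sqr_ge0.
by rewrite pmulr_lge0.
Qed.

Lemma gram_sym (R : comPzRingType) (n : nat) (A : 'M[R]_n) :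
  (A^T *m A)^T = A^T *m A.
Proof. by rewrite trmx_mul trmxK. Qed.

(** Links the supremum and infimum that define the extreme singular values to
    the spectrum.  The real supremum is meaningful only for bounded sets; here
    no eigenvalue exceeds the trace, since all of them are nonnegative. *)
Lemma gram_eigenvalue_bounds (R : realType) (n : nat) (A : 'M[R]_n) (a : R) :
  eigenvalue (A^T *m A) a ->
  [/\ 0 <= sigma_min A, sigma_min A <= sigma_max A,
      sigma_min A ^+ 2 <= a & a <= sigma_max A ^+ 2].
Proof.
move=> eiga; have a0 := gram_eigenvalue_ge0 eiga.
have [r [spec trE _]] := symmetric_spectrum (gram_sym A).
have r0 i : 0 <= r i.
  by apply: (@gram_eigenvalue_ge0 _ _ A); apply/spec; exists i.
have lbS : lbound (singular_values A) 0 by move=> s [].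
have ubS : has_ubound (singular_values A).
  exists (Num.sqrt (\tr (A^T *m A))) => s [s0 /spec[i sE]].
  rewrite -[s]ger0_norm // -sqrtr_sqr sE ler_wsqrtr // trE (bigD1 i) //=.
  by rewrite lerDl sumr_ge0.
have sa : singular_values A (Num.sqrt a).
  by split; [exact: sqrtr_ge0 | rewrite sqr_sqrtr].
have m0 : 0 <= sigma_min A by apply: lb_le_inf lbS; exists (Num.sqrt a).
have ma : sigma_min A <= Num.sqrt a by apply: ge_inf sa; exists 0.
have aM : Num.sqrt a <= sigma_max A by apply: ub_le_sup sa.
split=> //; first exact: le_trans aM.
  rewrite -(sqr_sqrtr a0).
  by rewrite lerXn2r ?nnegrE ?sqrtr_ge0.
rewrite -(sqr_sqrtr a0).
by rewrite lerXn2r ?nnegrE ?sqrtr_ge0 // (le_trans _ aM) ?sqrtr_ge0.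
Qed.

(** * Gram matrices of sign matrices *)

Section SignMatrix.

Variables (R : realType) (n : nat) (A : 'M[R]_n).
Hypothesis signA : sign_matrices A.

Let G := A^T *m A.

Lemma sign_gramE i j : G i j = \sum_l A l i * A l j.
Proof. by rewrite mxE; apply: eq_bigr => l _; rewrite mxE. Qed.

Lemma sign_gramC i j : G i j = G j i.
Proof. by rewrite !sign_gramE; apply: eq_bigr => l _; rewrite mulrC. Qed.

Lemma sign_gram_diag i : G i i = n%:R.
Proof.
rewrite sign_gramE (eq_bigr (fun=> 1)) ?sumr_const ?card_ord // => l _.
by case: (signA l i) => ->; rewrite ?mulrNN mulr1.
Qed.

Lemma sign_gram_int i j : G i j \is a Num.int.
Proof.
rewrite sign_gramE rpred_sum // => l _.
by case: (signA l i) => ->; case: (signA l j) => ->;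
  rewrite rpredM ?rpredN ?rpred1.
Qed.

(** For columns [a], [b], [c], the inner product of [a + b] and [a + c] is
    [n + <a, b> + <a, c> + <b, c>], and each of its terms is 0 or 4. *)
Lemma dvdn4_orthogonal_columns i j k :
  G i j = 0 -> G i k = 0 -> G j k = 0 -> (4 %| n)%N.
Proof.
move=> ij ik jk.
have termE l : A l i * A l i + A l i * A l j + A l i * A l k + A l j * A l k
    = (4 * ((A l i == A l j) && (A l i == A l k)))%:R.
  have one_neqN : (1 == -1 :> R) = false by apply/eqP; lra.
  have N_neq_one : (-1 == 1 :> R) = false by apply/eqP; lra.
  by case: (signA l i) => ->; case: (signA l j) => ->;
    case: (signA l k) => ->; rewrite ?eqxx ?one_neqN ?N_neq_one /=; lra.
have /esym :
    \sum_l (A l i * A l i + A l i * A l j + A l i * A l k + A l j * A l k) = n%:R.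
  by rewrite !big_split /= -!sign_gramE sign_gram_diag ij ik jk !addr0.
rewrite (eq_bigr _ (fun l _ => termE l)) -natr_sum -big_distrr /= => /eqP.
by rewrite eqr_nat => /eqP ->; rewrite dvdn_mulr.
Qed.

(** Putting 1 on the diagonal makes the inequality [1 <= F i j + F i k + F j k]
    hold for all triples, degenerate ones included.  Summing it over the
    [n ^ 3] triples counts every pair [3 * n] times. *)
Lemma sign_gram_offdiag : ~~ (4 %| n)%N ->
  n%:R ^+ 2 / 3 <= \sum_i \sum_j (if i == j then 1 else G i j ^+ 2).
Proof.
move=> n4; pose F i j := if i == j then 1 else G i j ^+ 2.
rewrite -/(\sum_i \sum_j F i j).
have F0 i j : 0 <= F i j by rewrite /F; case: ifP; rewrite ?sqr_ge0.
have F1 i j : G i j != 0 -> 1 <= F i j.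
  by rewrite /F; case: ifP => // _ Gij; rewrite sqr_intr_ge1 ?sign_gram_int.
have triple i j k : 1 <= F i j + (F i k + F j k).
  have := F0 i j; have := F0 i k; have := F0 j k.
  have [/F1|/negPn/eqP Gij] := boolP (G i j != 0); first lra.
  have [/F1|/negPn/eqP Gik] := boolP (G i k != 0); first lra.
  have [/F1|/negPn/eqP Gjk] := boolP (G j k != 0); first lra.
  by case/negP: n4; apply: dvdn4_orthogonal_columns Gij Gik Gjk.
have n0 : 0 < n%:R :> R by rewrite ltr0n; case: (n) n4.
rewrite ler_pdivrMr // -(ler_pM2l n0).
have -> : n%:R * n%:R ^+ 2 = \sum_(i < n) \sum_(j < n) \sum_(k < n) 1 :> R.
  rewrite !(sumr_const, card_ord) -!mulrnA !natrM; ring.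
have -> : n%:R * ((\sum_i \sum_j F i j) * 3) =
    \sum_i \sum_j \sum_k (F i j + (F i k + F j k)).
  have row i : \sum_j \sum_k (F i j + (F i k + F j k)) =
      2 * n%:R * \sum_j F i j + \sum_j \sum_k F j k.
    transitivity (\sum_j (n%:R * F i j + (\sum_k F i k + \sum_k F j k))).
      apply: eq_bigr => j _.
      by rewrite !big_split /= sumr_const card_ord mulr_natl.
    by rewrite !big_split /= sumr_const card_ord -mulr_sumr -mulr_natl; ring.
  rewrite (eq_bigr _ (fun i _ => row i)) big_split /= sumr_const card_ord.
  by rewrite -mulr_sumr -mulr_natl; ring.
by do 3 (apply: ler_sum => ? _); exact: triple.
Qed.

(** The trace of [G] is [n ^ 2], so expanding the squares turns the sum of
    squared deviations into [\tr (G *m G) - n ^ 3].  The trace of [G *m G] is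
    the sum of the squared entries of [G], and the diagonal accounts for
    [n ^ 3] of it. *)
Lemma sign_gram_spread (r : 'I_n -> R) : ~~ (4 %| n)%N ->
  \tr G = \sum_i r i -> \tr (G *m G) = \sum_i r i ^+ 2 ->
  n%:R ^+ 2 / 3 - n%:R <= \sum_i (r i - n%:R) ^+ 2.
Proof.
move=> n4 tr1 tr2.
have trG : \tr G = n%:R ^+ 2.
  rewrite /mxtrace (eq_bigr _ (fun i _ => sign_gram_diag i)).
  by rewrite sumr_const card_ord expr2 mulr_natl.
have trGG : \tr (G *m G) =
    \sum_i \sum_j (if i == j then 1 else G i j ^+ 2) + n%:R * (n%:R ^+ 2 - 1).
  have -> : n%:R * (n%:R ^+ 2 - 1) = \sum_(i < n) (n%:R ^+ 2 - 1) :> R.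
    by rewrite sumr_const card_ord mulr_natl.
  rewrite -big_split; apply: eq_bigr => i _ /=.
  rewrite mxE (bigD1 i) //= [in RHS](bigD1 i) //= eqxx sign_gram_diag.
  rewrite [X in _ + X = _](eq_bigr (fun j => if i == j then 1 else G i j ^+ 2)).
    by ring.
  move=> j; rewrite eq_sym => /negPf ->.
  by rewrite expr2 (sign_gramC j).
have -> : \sum_i (r i - n%:R) ^+ 2 =
    \sum_i r i ^+ 2 - 2 * n%:R * \sum_i r i + n%:R ^+ 3.
  have -> : n%:R ^+ 3 = \sum_(i < n) n%:R ^+ 2 :> R.
    by rewrite sumr_const card_ord exprS mulr_natl.
  rewrite mulr_sumr -sumrB -big_split; apply: eq_bigr => i _ /=; ring.
rewrite -tr1 -tr2 trG trGG.
have := sign_gram_offdiag n4; move: (\sum_i _) (n%:R) => S x; lra.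
Qed.

End SignMatrix.

(** * The condition number *)

(** From [ln x < x] at the square root of [n]. *)
Lemma ln_sqr_le (R : realType) (n : nat) : (0 < n)%N ->
  ln (n%:R : R) ^+ 2 <= 4 * n%:R.
Proof.
move=> n0; have n0' : 0 < n%:R :> R by rewrite ltr0n.
pose s := Num.sqrt (n%:R : R).
have s_gt0 : 0 < s by rewrite sqrtr_gt0.
have sE : s ^+ 2 = n%:R by rewrite sqr_sqrtr // ltW.
have : 0 <= ln (n%:R : R) by rewrite ln_ge0 // ler1n.
have := ln_sublinear s_gt0; rewrite -sE lnXn // mulr2n => L_lt L_ge0.
have -> : 4 * s ^+ 2 = (s + s) ^+ 2 by ring.
by rewrite lerXn2r ?nnegrE //; lra.
Qed.

(** The variance bound confronted with the spectral interval.  The threshold 6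
    gives [n ^ 2 / 3 - n >= n ^ 2 / 6]. *)
Lemma sign_condition_number (R : realType) (n : nat) (A : 'M[R]_n) :
  (6 <= n)%N -> ~~ (4 %| n)%N -> sign_matrices A -> sigma_min A != 0 ->
  1 <= sigma_max A / sigma_min A /\
  6^-1 <= n%:R * ((sigma_max A / sigma_min A) ^+ 2 - 1) ^+ 2.
Proof.
move=> n6 n4 signA m_neq0.
have n6' : 6 <= n%:R :> R by rewrite ler_nat.
have [r [spec tr1 tr2]] := symmetric_spectrum (gram_sym A).
have bnd i := gram_eigenvalue_bounds ((spec (r i)).2 (ex_intro _ i erefl)).
have m0 : 0 < sigma_min A.
  by rewrite lt0r m_neq0; case: (bnd (Ordinal (leq_trans _ n6 : 0 < n)%N)).
have mM : sigma_min A <= sigma_max A.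
  by case: (bnd (Ordinal (leq_trans _ n6 : 0 < n)%N)).
split; first by rewrite ler_pdivlMr // mul1r.
have spread := sign_gram_spread signA n4 tr1 tr2.
have mean : \sum_i r i = n%:R * n%:R.
  rewrite -tr1 /mxtrace (eq_bigr _ (fun i _ => sign_gram_diag signA i)).
  by rewrite sumr_const card_ord mulr_natl.
have sumc (c : R) : \sum_(i < n) c = n%:R * c.
  by rewrite sumr_const card_ord mulr_natl.
set m := sigma_min A in m0 bnd *; set M := sigma_max A in bnd *.
(* The mean of the eigenvalues lies in the same interval as they do. *)
have mn : m ^+ 2 <= n%:R.
  rewrite -(@ler_pM2l _ n%:R); last lra.
  by rewrite -mean -sumc; apply: ler_sum => i _; case: (bnd i).
have nM : n%:R <= M ^+ 2.
  rewrite -(@ler_pM2l _ n%:R); last lra.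
  by rewrite -mean -sumc; apply: ler_sum => i _; case: (bnd i).
have wide : n%:R ^+ 2 / 3 - n%:R <= n%:R * (M ^+ 2 - m ^+ 2) ^+ 2.
  apply: le_trans spread _; rewrite -sumc; apply: ler_sum => i _.
  have [_ _ mr rM] := bnd i; nra.
have -> : (M / m) ^+ 2 - 1 = (M ^+ 2 - m ^+ 2) / m ^+ 2.
  by field; rewrite gt_eqF.
have m20 : 0 < m ^+ 2 by rewrite exprn_gt0.
rewrite expr_div_n mulrA ler_pdivlMr ?exprn_gt0 //.
move: wide mn m20 n6'; move: (n%:R) (m ^+ 2) (M ^+ 2) => N a b; nra.
Qed.

Theorem theorem6 (R : realType) :
  exists2 c : R, 0 < c &
    exists N : nat, forall n : nat, (0 < n)%N -> (N <= n)%N ->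
      ~~ (4 %| n)%N ->
      ((1 + c * ln n%:R / n%:R)%:E <= min_cond_number R n)%E.
Proof.
(* With [x <= 1 + t / 16], [t = ln n / n <= 1] and [n * t ^ 2 <= 4], one gets
   [x ^ 2 - 1 <= 3 * t / 16], so [n * (x ^ 2 - 1) ^ 2 <= 9 / 64 < 1 / 6]. *)
exists 16^-1; first by rewrite invr_gt0.
exists 6%N => n n0 n6 n4; apply: le_ereal_inf_tmp => _ [A signA <-].
rewrite /cond_number; case: eqP => [_|/eqP m0]; first by rewrite leey.
have [x0 spread] := sign_condition_number n6 n4 signA m0.
rewrite lee_fin leNgt; apply/negP => small.
have npos : 0 < n%:R :> R by rewrite ltr0n.
have lnn := ln_sqr_le R n0; have ln_n := ln_sublinear npos.
have l0 : 0 <= ln (n%:R : R) by rewrite ln_ge0 // ler1n.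
pose t := ln n%:R / n%:R : R.
have t0 : 0 <= t by rewrite divr_ge0 // ltW.
have t1 : t <= 1 by rewrite ler_pdivrMr // mul1r ltW.
have nt : n%:R * t ^+ 2 <= 4.
  have -> : n%:R * t ^+ 2 = ln n%:R ^+ 2 / n%:R.
    by rewrite /t; field; rewrite gt_eqF.
  by rewrite ler_pdivrMr.
move: small spread x0; rewrite -mulrA -/t.
move: (sigma_max A / _) => x small spread x0.
have y_le : (x ^+ 2 - 1) <= 3 / 16 * t by nra.
have y0 : 0 <= x ^+ 2 - 1 by nra.
have : (x ^+ 2 - 1) ^+ 2 <= (3 / 16 * t) ^+ 2 by nra.
rewrite -(ler_pM2l npos); nra.
Qed.
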